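(* Let $n\ge 2$ and let $F$ be a real algebraic number field of degree $n$ over $\mathbb{Q}$. Let $\phi$ be an $F$-algebraic quasiperiodic flow on $T^n$ (generated by a constant vector field), and let $\psi$ be a flow on $T^n$ generated by a constant vector field. If $\phi$ is smoothly semiconjugate to $\psi$ and $M_\psi\subset M_\phi$, then $\psi$ is an $F$-algebraic quasiperiodic flow and $M_\psi$ is a finite index subgroup of $M_\phi$.
   Context: $T^n=\mathbb{R}^n/\mathbb{Z}^n$ is the $n$-torus with global coordinates $(\theta_1,\dots,\theta_n)$. For a smooth ($C^\infty$) flow $\phi:\mathbb{R}\times T^n\to T^n$, its generating vector field is $X_\phi(p)=\frac{d}{dt}\phi(t,p)|_{t=0}$. A constant vector field is one of the form $\sum_{i=1}^n a_i\,\partial/\partial\theta_i$ with $a_i\in\mathbb{R}$; the $a_i$ are its components. A flow generated by a constant vector field is quasiperiodic if the components $a_1,\dots,a_n$ are linearly independent over $\mathbb{Q}$. Generalized symmetry group: $S_\phi$ is the group of all $R\in\mathrm{Diff}(T^n)$ (smooth diffeomorphisms) for which there is $\alpha\in\mathbb{R}^*=\mathbb{R}\setminus\{0\}$ with $R_*X_\phi=\alpha X_\phi$, where $R_*X_\phi=\mathbf{T}R\,X_\phi\,R^{-1}$ is the push-forward and $\mathbf{T}R$ is the derivative map of $R$. The unique such $\alpha$ is the multiplier $\rho_\phi(R)$, and the multiplier group is $M_\phi=\rho_\phi(S_\phi)\subset\mathbb{R}^*$, i.e. the set of all $\alpha\in\mathbb{R}^*$ for which some $R\in\mathrm{Diff}(T^n)$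 satisfies $R_*X_\phi=\alpha X_\phi$. A real algebraic number field of degree $n$ over $\mathbb{Q}$ is a subfield of $\mathbb{R}$ that is an $n$-dimensional vector space over $\mathbb{Q}$. A quasiperiodic flow $\phi$ on $T^n$ generated by $X_\phi=\sum a_i\,\partial/\partial\theta_i$ is called $F$-algebraic, for $F$ such a field of degree $n$, if there is $\vartheta\in\mathbb{R}^*$ such that $\{\vartheta a_1,\dots,\vartheta a_n\}$ is a $\mathbb{Q}$-basis of $F$. A flow $\phi$ on $T^n$ is smoothly semiconjugate to a flow $\psi$ on $T^n$ if there is a surjective smooth map $V:T^n\to T^n$ such that $\mathbf{T}V\,X_\phi=X_\psi\circ V$. *)

(* Defs.v *)
From HB Require Import structures.
From mathcomp Require Import all_boot all_order all_algebra.
From mathcomp Require Import all_classical all_reals all_analysis.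

Set Implicit Arguments.
Unset Strict Implicit.
Unset Printing Implicit Defensive.

Import Order.TTheory GRing.Theory Num.Theory.
Import numFieldNormedType.Exports.

Local Open Scope classical_set_scope.
Local Open Scope ring_scope.

Section Smooth.
Variables (R : realType) (E F : normedModType R).

Definition iter_derive (s : seq E) (f : E -> F) : E -> F :=
  foldr (fun v g x => 'D_v g x) f s.

(* All iterated directional derivatives exist and are continuous on a
   neighbourhood of x. For finite-dimensional E this is C^oo near x. *)
Definition smooth_near (f : E -> F) (x : E) : Prop :=
  \forall y \near x, forall s : seq E,
    {for y, continuous (iter_derive s f)} /\
    (forall v : E, derivable (iter_derive s f) y v).

End Smooth.

Section Torus.
Variables (R : realType) (n : nat).

(* The row vectors with entries in Num.int. *)
Definition int_lattice : zmodClosed 'rV[R]_n :=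
  GRing.ZmodClosed.clone 'rV[R]_n (mxOver_pred Num.int_num_subdef) _.

Definition torus : zmodType := Quotient.quot int_lattice.

Definition torus_pi (x : 'rV[R]_n) : torus := (\pi_torus x)%qT.

(* The representative of p in the cube [-1/2, 1/2[ ^ n. *)
Definition torus_log (p : torus) : 'rV[R]_n :=
  \row_i (repr p 0 i - (Num.floor (repr p 0 i + 2^-1))%:~R).

(* The charts [chart q], restricted to the open sets
   q + torus_pi (]-1/2, 1/2[ ^ n), form a smooth atlas of the torus. Each of
   them is q + torus_pi x |-> x, so it carries the global frame
   d/dtheta_1, ..., d/dtheta_n to the standard one of R^n: tangent vectors are
   written in this frame as elements of 'rV[R]_n, whatever the base point. *)
Definition chart (q p : torus) : 'rV[R]_n := torus_log (p - q).

(* Continuity of f is included: [chart (f x) (f y)] vanishes at y = x and is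
   continuous near x, so f y stays in the domain of the chart at f x. *)
Definition smooth_to_torus (E : normedModType R) (f : E -> torus) : Prop :=
  forall x : E, smooth_near (fun y => chart (f x) (f y)) x.

(* torus_pi is a local diffeomorphism. *)
Definition smooth_map (V : torus -> torus) : Prop :=
  smooth_to_torus (V \o torus_pi).

Definition tangent_map (V : torus -> torus) (p : torus) (v : 'rV[R]_n) :
    'rV[R]_n :=
  'D_v (fun y : 'rV[R]_n => chart (V p) (V (p + torus_pi y))) 0.

Definition diffeo (f finv : torus -> torus) : Prop :=
  [/\ smooth_map f, smooth_map finv, cancel f finv & cancel finv f].

Definition vector_field := torus -> 'rV[R]_n.

Definition pushforward (f finv : torus -> torus) (X : vector_field) :
    vector_field :=
  fun q => tangent_map f (finv q) (X (finv q)).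

Record flow := Flow {
  flow_fun :> R -> torus -> torus ;
  flow0 : forall p, flow_fun 0 p = p ;
  flowD : forall s t p, flow_fun (s + t) p = flow_fun s (flow_fun t p) ;
  flow_smooth : smooth_to_torus
    (fun z : (R * 'rV[R]_n)%type => flow_fun z.1 (torus_pi z.2)) }.

Definition generating_field (phi : flow) : vector_field :=
  fun p => derive1 (fun t : R => chart p (phi t p)) 0.

Definition generated_by_constant (phi : flow) (a : 'rV[R]_n) : Prop :=
  forall p, generating_field phi p = a.

Definition multiplier_group (phi : flow) : set R :=
  [set alpha | alpha != 0 /\ exists f finv : torus -> torus,
    diffeo f finv /\
    forall q, pushforward f finv (generating_field phi) q
              = alpha *: generating_field phi q].

Definition smoothly_semiconjugate (phi psi : flow) : Prop :=
  exists V : torus -> torus,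
    [/\ smooth_map V,
        forall q, exists p, V p = q &
        forall p, tangent_map V p (generating_field phi p)
                  = generating_field psi (V p)].

Definition rat_independent (e : 'I_n -> R) : Prop :=
  forall c : 'I_n -> rat,
    \sum_(i < n) ratr (c i) * e i = 0 -> forall i, c i = 0.

Definition rat_basis (F : {pred R}) (e : 'I_n -> R) : Prop :=
  [/\ forall i, e i \in F,
      rat_independent e &
      forall x, x \in F ->
        exists c : 'I_n -> rat, x = \sum_(i < n) ratr (c i) * e i].

(* F is a subfield of R with [F : Q] = n. *)
Definition real_number_field (F : {pred R}) : Prop :=
  GRing.divring_closed F /\ exists e : 'I_n -> R, rat_basis F e.

Definition quasiperiodic (phi : flow) (a : 'rV[R]_n) : Prop :=
  generated_by_constant phi a /\ rat_independent (fun i => a 0 i).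

Definition algebraic_flow (F : {pred R}) (phi : flow) : Prop :=
  exists a : 'rV[R]_n, quasiperiodic phi a /\
    exists theta : R, theta != 0 /\ rat_basis F (fun i => theta * a 0 i).

End Torus.

Definition mul_subgroup (R : realType) (G : set R) : Prop :=
  [/\ forall x, G x -> x != 0, G 1 & forall x y, G x -> G y -> G (x / y)].

Definition finite_index_subgroup (R : realType) (H G : set R) : Prop :=
  [/\ mul_subgroup G, mul_subgroup H, H `<=` G &
      finite_set [set [set x * y | y in H] | x in G]].

(* Main.v *)
Require Import Defs.
From HB Require Import structures.
From mathcomp Require Import all_boot all_order all_algebra.
From mathcomp Require Import all_classical all_reals all_analysis.
From mathcomp Require Import ring lra zify.

(* Write a and b for the generators of phi and psi. A semiconjugacy V sends the
   orbit p + t a to V p + t b, so V (p + q) - V q = V p - V 0 holds for q on the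
   orbit of 0, which is dense because the entries of a are rationally
   independent, hence for all q. Therefore V x = V 0 + x B for an integer matrix
   B with b = a B, and det B <> 0 because V is surjective. The same rigidity
   applied to the diffeomorphisms R with R_* X = alpha X identifies the
   multiplier group with the set of alpha such that a U = alpha a for some
   U in GL_n(Z). If U and U' in GL_n(Z) are congruent modulo det B, then
   B^-1 U U'^-1 B is integral, so the ratio of their multipliers belongs to the
   group of b = a B; there are finitely many congruence classes. *)

Import Order.TTheory GRing.Theory Num.Theory.
Import numFieldNormedType.Exports.

Local Open Scope classical_set_scope.

Set Implicit Arguments.
Unset Strict Implicit.
Unset Printing Implicit Defensive.

(** * Lifts, lattice and quotient norm on the torus *)

Section TorusMetric.
Local Open Scope ring_scope.
Variables (R : realType) (n : nat).
Implicit Types (x y : 'rV[R]_n) (p q : torus R n).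

Lemma torus_piD x y : torus_pi (x + y) = torus_pi x + torus_pi y.
Proof. exact: (@Quotient.pi_add _ (int_lattice R n)). Qed.

Lemma torus_piN x : torus_pi (- x) = - torus_pi x.
Proof. exact: (@Quotient.pi_opp _ (int_lattice R n)). Qed.

Lemma torus_piB x y : torus_pi (x - y) = torus_pi x - torus_pi y.
Proof. by rewrite torus_piD torus_piN. Qed.

Lemma torus_pi_repr p : torus_pi (repr p) = p.
Proof. exact: reprK. Qed.

Lemma torus_pi_eq x y :
  torus_pi x = torus_pi y <-> forall i, x 0 i - y 0 i \is a Num.int.
Proof.
split=> [/eqP|h].
  rewrite /torus_pi -(Quotient.idealrBE (int_lattice R n)) => /mxOverP h i.
  by have := h 0 i; rewrite !mxE.
apply/eqP; rewrite /torus_pi -(Quotient.idealrBE (int_lattice R n)).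
by apply/mxOverP => i j; rewrite ord1 !mxE; exact: h.
Qed.

Lemma torus_pi0 : torus_pi (0 : 'rV[R]_n) = 0.
Proof. by rewrite -(subrr (0 : 'rV[R]_n)) torus_piB subrr. Qed.

Lemma torus_pi_eq0 x : torus_pi x = 0 <-> forall i, x 0 i \is a Num.int.
Proof.
rewrite -torus_pi0 torus_pi_eq; split=> h i; have := h i; by rewrite mxE subr0.
Qed.

Lemma torus_pi_delta i : torus_pi (delta_mx 0 i : 'rV[R]_n) = 0.
Proof. by apply/torus_pi_eq0 => j; rewrite mxE eqxx /= natr_int. Qed.

Lemma torus_pi_int (m : 'rV[int]_n) : torus_pi (map_mx intr m : 'rV[R]_n) = 0.
Proof. by apply/torus_pi_eq0 => i; rewrite mxE intr_int. Qed.

Lemma torus_pi_intD x (m : 'rV[int]_n) :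
  torus_pi (x + map_mx intr m) = torus_pi x.
Proof. by rewrite torus_piD torus_pi_int addr0. Qed.

Lemma torus_pi_eqP x y :
  torus_pi x = torus_pi y -> exists m : 'rV[int]_n, x = y + map_mx intr m.
Proof.
move=> /torus_pi_eq h; exists (\row_i Num.floor (x 0 i - y 0 i)).
apply/rowP => i; rewrite !mxE.
by have := h i; rewrite intrEfloor => /eqP ->; rewrite addrC subrK.
Qed.

Lemma torus_logK p : torus_pi (torus_log p) = p.
Proof.
rewrite -{2}(torus_pi_repr p); apply/torus_pi_eq => i.
by rewrite mxE addrAC subrr sub0r rpredN intr_int.
Qed.

Lemma row_norm_le x e : 0 <= e -> (forall i, `|x 0 i| <= e) -> `|x| <= e.
Proof.
move=> e0 h; rewrite -[`|x|]/(mx_norm x) mx_normrE.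
by apply: bigmax_le => // -[i j] _; rewrite ord1.
Qed.

Lemma row_norm_ge x i : `|x 0 i| <= `|x|.
Proof.
rewrite -[`|x|]/(mx_norm x) mx_normrE.
exact: (le_bigmax _ (fun ij : 'I_1 * 'I_n => `|x ij.1 ij.2|) (0, i)).
Qed.

(** The floor of [t + 1/2] lies within 1/2 of [t], so every other integer is at distance at least
    1/2. *)
Lemma floor_half_le (t : R) (m : int) :
  `|t - (Num.floor (t + 2^-1))%:~R| <= `|t - m%:~R|.
Proof.
have := floor_le (t + 2^-1).
have := floorD1_gt (t + 2^-1).
set k := Num.floor _ => h1 h2.
have [<-|km] := eqVneq k m; first by [].
have h3 : `|t - k%:~R| <= 2^-1 by rewrite ler_norml; lra.
apply: le_trans h3 _.
case: (ltgtP k m) km => // km _.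
  have : (k + 1)%:~R <= m%:~R :> R by rewrite ler_int lezD1.
  by rewrite intrD => h; rewrite ler_normr; apply/orP; right; lra.
have : (m + 1)%:~R <= k%:~R :> R by rewrite ler_int lezD1.
by rewrite intrD => h; rewrite ler_normr; apply/orP; left; lra.
Qed.

(** Each coordinate is reduced by a nearest integer, so [torus_log] is a shortest lift and its norm
    is the quotient norm. The triangle inequality and the symmetry below follow from this. *)
Lemma torus_log_pi_le x : `|torus_log (torus_pi x)| <= `|x|.
Proof.
apply: row_norm_le => // i; rewrite mxE.
have /torus_pi_eqP[m ->] := torus_pi_repr (torus_pi x).
rewrite !mxE; apply: le_trans (floor_half_le _ (m 0 i)) _.
by rewrite addrK row_norm_ge.
Qed.

(** Two lifts of norm below 1/2 differ by an integer vector with entries of absolute value below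
    1. *)
Lemma torus_log_small x : `|x| < 2^-1 -> torus_log (torus_pi x) = x.
Proof.
move=> hx; have hl := le_lt_trans (torus_log_pi_le x) hx.
have /torus_pi_eq h := torus_logK (torus_pi x).
apply/rowP => i; apply/eqP; rewrite -subr_eq0.
have /intrP[k hk] := h i; rewrite hk intr_eq0.
have h1 := le_lt_trans (row_norm_ge x i) hx.
have h2 := le_lt_trans (row_norm_ge _ i) hl.
have : `|k%:~R| < 1 :> R.
  rewrite -hk; apply: le_lt_trans (ler_normB _ _) _.
  by rewrite [ltRHS](splitr 1) mul1r ltrD.
by rewrite -intr_norm (_ : 1 = 1%:~R) // ltr_int; lia.
Qed.

Lemma torus_log0 : torus_log (0 : torus R n) = 0.
Proof. by rewrite -torus_pi0 torus_log_small ?normr0. Qed.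

Lemma torus_log_normD p q :
  `|torus_log (p + q)| <= `|torus_log p| + `|torus_log q|.
Proof.
rewrite -{1}(torus_logK p) -{1}(torus_logK q) -torus_piD.
exact: le_trans (torus_log_pi_le _) (ler_normD _ _).
Qed.

Lemma torus_log_normN p : `|torus_log (- p)| = `|torus_log p|.
Proof.
suff h q : `|torus_log (- q)| <= `|torus_log q|.
  by apply/eqP; rewrite eq_le h -{1}(opprK p) h.
rewrite -{1}(torus_logK q) -torus_piN -[leRHS]normrN; exact: torus_log_pi_le.
Qed.

Lemma torus_log_norm_eq0 p : `|torus_log p| = 0 -> p = 0.
Proof.
by move=> /normr0_eq0 h; rewrite -(torus_logK p) h torus_pi0.
Qed.

Lemma torus_log_dist p q :
  `| `|torus_log p| - `|torus_log q| | <= `|torus_log (p - q)|.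
Proof.
have h p' q' : `|torus_log p'| - `|torus_log q'| <= `|torus_log (p' - q')|.
  by rewrite lerBlDr; apply: le_trans (torus_log_normD _ _); rewrite subrK.
rewrite ler_norml h andbT lerNl opprB; apply: le_trans (h _ _) _.
by rewrite -torus_log_normN opprB.
Qed.

End TorusMetric.

(** * Velocities of curves and of their images under smooth maps *)

Section Curves.
Local Open Scope ring_scope.
Variables (R : realType) (n : nat).
Implicit Types (c : R -> torus R n) (b v x : 'rV[R]_n).

(* For k t = |log (c t - t b - c 0)| one has |k (t + h) - k t| = o(h), hence
   k' = 0. *)
Lemma constant_velocity_curve c b :
  (forall t, (fun h => h^-1 *: chart (c t) (c (t + h))) @ 0^' --> b) ->
  forall t, c t = c 0 + torus_pi (t *: b).
Proof.
move=> hc; pose u t := c t - torus_pi (t *: b).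
pose k t : R := `|torus_log (u t - c 0)|.
have k0 t : is_derive t (1 : R) k 0.
  suff hk : (fun h => h^-1 *: (k (h *: 1 + t) - k t)) @ 0^' --> (0 : R).
    by apply: DeriveDef; [apply/cvg_ex; exists 0 | exact: (cvg_lim _ hk)].
  apply/cvgr0Pnorm_le => e e0.
  have /cvgrPdist_le /(_ e e0) := hc t.
  have : \forall h \near (0 : R)^', h != 0 by exact: nbhs_dnbhs_neq.
  apply: filterS2 => h h0 hb.
  rewrite /= -[_ *: 1]/(h * 1) mulr1 normrZ.
  (* The reverse triangle inequality bounds the increment of [k] by that of [u], which is the chart
     increment minus [h *: b]. *)
  have : `|k (h + t) - k t| <= `|chart (c t) (c (t + h)) - h *: b|.
    apply: le_trans (torus_log_dist _ _) _.
    rewrite opprB addrA subrK [h + t]addrC.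
    suff -> : u (t + h) - u t = torus_pi (chart (c t) (c (t + h)) - h *: b).
      exact: torus_log_pi_le.
    rewrite torus_piB torus_logK /u scalerDl torus_piD opprB opprD -!addrA.
    by congr (_ + _); rewrite addrCA addKr addrC.
  move=> hl; apply: le_trans hb.
  rewrite [leRHS]distrC -[X in _ <= `|_ - X|](scale1r b) -(mulVf h0) -scalerA.
  by rewrite -scalerBr normrZ ler_wpM2l.
move=> t; have : k t = 0.
  rewrite (is_derive_0_is_cst t 0 k0) /k /u scale0r torus_pi0 subr0 subrr.
  by rewrite torus_log0 normr0.
move=> /torus_log_norm_eq0 /eqP; rewrite /u subr_eq0 subr_eq => /eqP.
exact.
Qed.

Lemma chart_id (p : torus R n) : chart p p = 0.
Proof. by rewrite /chart subrr torus_log0. Qed.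

(** The empty list of directions in [smooth_near], at the lift [repr p], already gives derivability;
    the base point is then translated to 0. *)
Lemma smooth_map_velocity (V : torus R n -> torus R n) (smV : smooth_map V)
    p v :
  (fun h : R => h^-1 *: chart (V p) (V (p + torus_pi (h *: v)))) @ 0^' -->
    tangent_map V p v.
Proof.
set g := fun y => chart (V p) (V (p + torus_pi y)).
have hg : derivable g 0 v.
  have /nbhs_singleton /(_ [::])[_ /(_ v)] := smV (repr p).
  rewrite /= /comp torus_pi_repr /derivable /= => h.
  suff -> : (fun h => h^-1 *: (g (h *: v + 0) - g 0)) =
   (fun h => h^-1 *: (chart (V p) (V (torus_pi (h *: v + repr p)))
      - chart (V p) (V (torus_pi (repr p))))) by exact: h.
  apply/funext => s; rewrite /g addr0 torus_piD torus_pi_repr torus_pi0 addr0.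
  by rewrite [p + _]addrC.
have : (fun h => h^-1 *: (g (h *: v + 0) - g 0)) @ 0^' --> 'D_v g 0.
  exact: hg.
suff -> : (fun h => h^-1 *: (g (h *: v + 0) - g 0)) =
  (fun h => h^-1 *: chart (V p) (V (p + torus_pi (h *: v)))) by [].
by apply/funext => s; rewrite /g addr0 torus_pi0 addr0 chart_id subr0.
Qed.

Lemma smooth_map_cvg (V : torus R n -> torus R n) (smV : smooth_map V) p :
  (fun x : 'rV[R]_n => chart (V p) (V (p + torus_pi x))) @ (0 : 'rV[R]_n) -->
    (0 : 'rV[R]_n).
Proof.
have /nbhs_singleton /(_ [::])[h _] := smV (repr p).
have {h} : (fun y => chart (V p) (V (torus_pi y))) @ repr p -->
    chart (V p) (V (torus_pi (repr p))).
  by move: h; rewrite /prop_for /continuous_at /= /comp torus_pi_repr.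
rewrite torus_pi_repr chart_id -{1}[repr p]add0r -cvg_comp_shift.
suff -> : (fun y => chart (V p) (V (torus_pi y))) \o shift (repr p) =
  (fun x => chart (V p) (V (p + torus_pi x))) by [].
by apply/funext => x; rewrite /= torus_piD torus_pi_repr addrC.
Qed.

End Curves.

Arguments smooth_map_velocity {R n V} smV p v.
Arguments smooth_map_cvg {R n V} smV p.

(** * Dirichlet and Kronecker approximation *)

Section Kronecker.
Local Open Scope ring_scope.
Variable R : realType.

Lemma dirichlet_approximation k (theta : 'I_k -> R) (e : R) : 0 < e ->
  exists2 q : nat, (0 < q)%N &
    exists p : 'I_k -> int, forall i, `|q%:R * theta i - (p i)%:~R| < e.
Proof.
(* The unit interval is cut into [N.+1] boxes, of length [K^-1 < e]. *)
move=> e0; pose N := Num.truncn e^-1; pose K : R := N.+1%:R.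
have K0 : 0 < K by rewrite ltr0n.
have Ke : K^-1 < e by rewrite invf_plt ?posrE // /K truncnS_gt.
pose frac (x : R) := x - (Num.floor x)%:~R.
pose box x : 'I_N.+1 := inord `|Num.floor (K * frac x)|%N.
have frac01 x : 0 <= frac x < 1.
  rewrite /frac; have := floor_le x; have := floorD1_gt x.
  by rewrite intrD; lra.
have box_eq x y : box x = box y -> `|frac x - frac y| < K^-1.
  have fl z :
      (0 <= Num.floor (K * frac z)) /\ (Num.floor (K * frac z) < N.+1%:Z).
    have /andP[h0 h1] := frac01 z.
    rewrite floor_ge0 mulr_ge0 ?(ltW K0) //; split=> //.
    by rewrite floor_lt_int -[ltRHS]mulr1 ltr_pM2l.
  move=> /(congr1 val); have [x0 xN] := fl x; have [y0 yN] := fl y.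
  rewrite /box /= !inordK; [|lia|lia] => hxy.
  have {}hxy : Num.floor (K * frac x) = Num.floor (K * frac y) by lia.
  rewrite -(ltr_pM2l K0) mulfV ?gt_eqF // -{1}(gtr0_norm K0) -normrM mulrBr.
  have := floor_le (K * frac x); have := floorD1_gt (K * frac x).
  have := floor_le (K * frac y); have := floorD1_gt (K * frac y).
  rewrite hxy intrD => *; rewrite ltr_norml; lra.
pose T := {ffun 'I_k -> 'I_N.+1}.
(* Pigeonhole: there is one multiple more than there are boxes of the cube. The difference of two
   multiples in the same box is the required [q]. *)
pose f (q : 'I_#|T|.+1) : T := [ffun i => box (q%:R * theta i)].
have : ~~ injectiveb f.
  by apply/injectiveP => /leq_card; rewrite card_ord ltnn.
case/injectivePn => q1 [q2 q12 fq].
wlog lt12 : q1 q2 q12 fq / (q1 < q2)%N.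
  move=> h; case: (ltngtP q1 q2) => [lt|lt|/val_inj eq].
  - exact: h lt.
  - by apply: (h q2 q1) lt; rewrite // eq_sym.
  - by rewrite eq eqxx in q12.
exists (q2 - q1)%N; first by rewrite subn_gt0.
exists (fun i => Num.floor (q2%:R * theta i) - Num.floor (q1%:R * theta i)).
move=> i; have /ffunP/(_ i) := fq; rewrite !ffunE => /esym /box_eq h.
apply: lt_trans Ke; move: h; congr (`|_| < _).
by rewrite /frac natrB ?(ltnW lt12) // intrB; ring.
Qed.

(* Induction on the dimension (Estermann): after dividing by the first
   frequency, Dirichlet gives a nearly integral multiple of the others, whose
   remainders are again independent frequencies, in one dimension less. *)
Lemma kronecker_approximation k (a : 'I_k -> R) : rat_independent a ->
  forall (y : 'I_k -> R) (e : R), 0 < e ->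
  exists (t : R) (m : 'I_k -> int), forall i, `|t * a i - y i - (m i)%:~R| < e.
Proof.
elim: k a => [|k IHk] a ha y e e0; first by exists 0, (fun=> 0) => -[].
have a0 : a ord0 != 0.
  apply/eqP => a0; pose c (i : 'I_k.+1) : rat := (i == ord0)%:R.
  have /(_ ord0) : forall i, c i = 0.
    apply: ha; rewrite big_ord_recl big1 ?a0 ?mulr0 ?addr0 // => i _.
    by rewrite /c /= rmorph0 mul0r.
  by rewrite /c eqxx => /eqP; rewrite oner_eq0.
pose theta i := a (lift ord0 i) / a ord0.
have e2 : 0 < e / 2 by rewrite divr_gt0.
have [q q0 [p hp]] := dirichlet_approximation theta e2.
pose phi i := q%:R * theta i - (p i)%:~R.
have hphi : rat_independent phi.
  move=> c hc i.
  (* Since [phi i * a ord0 = q * a (lift ord0 i) - p i * a ord0], a relation [c] among the [phi i]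
     becomes this relation among the [a i]. *)
  pose c' (i : 'I_k.+1) : rat :=
    if unlift ord0 i is Some j then c j * q%:R else - \sum_j c j * (p j)%:~R.
  have /(_ (lift ord0 i)) : forall i, c' i = 0.
    apply: ha; rewrite big_ord_recl {1}/c' unlift_none.
    have -> : \sum_(i < k) ratr (c' (lift ord0 i)) * a (lift ord0 i) =
        \sum_(i < k) (ratr (c i) * phi i + ratr (c i) * (p i)%:~R) * a ord0.
      apply: eq_bigr => j _; rewrite /c' liftK rmorphM /= ratr_nat /phi /theta.
      by field.
    rewrite -mulr_suml big_split /= hc add0r -mulrDl rmorphN rmorph_sum /=.
    rewrite (eq_bigr (fun i => ratr (c i) * (p i)%:~R)) ?addNr ?mul0r // => j _.
    by rewrite rmorphM /= ratr_int.
  rewrite /c' liftK => /eqP; rewrite mulf_eq0 pnatr_eq0 eqn0Ngt q0 orbF.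
  by move=> /eqP.
(* Time [y ord0 / a ord0] settles the first coordinate and moves the others by [y ord0 * theta i],
   which is subtracted from their targets. *)
have [t [m htm]] :=
  IHk phi hphi (fun i => y (lift ord0 i) - y ord0 * theta i) _ e2.
pose s := Num.floor t.
(* The integer [s] keeps the first coordinate exact modulo 1. Replacing [t] by its floor changes the
   others by at most [|phi j| < e / 2]. *)
exists (((s * q%:Z)%:~R + y ord0) / a ord0).
exists (fun i => if unlift ord0 i is Some j then m j + s * p j else s * q%:Z).
move=> i; case: (unliftP ord0 i) => [j|] ->;
  rewrite ?unlift_none ?liftK; last first.
  by rewrite divfK // addrK subrr normr0.
have -> : ((s * q%:Z)%:~R + y ord0) / a ord0 * a (lift ord0 j) - y (lift ord0 j)
    - (m j + s * p j)%:~R =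
  (t * phi j - (y (lift ord0 j) - y ord0 * theta j) - (m j)%:~R)
  - (t - s%:~R) * phi j.
  by rewrite /phi /theta intrD !intrM; field.
apply: le_lt_trans (ler_normB _ _) _; rewrite [ltRHS](splitr e).
apply: ltr_leD; first exact: htm.
rewrite normrM -[leRHS]mul1r; apply: ler_pM => //; last exact/ltW/hp.
have := floor_le t; have := floorD1_gt t; rewrite intrD -/s => *.
by rewrite ler_norml; lra.
Qed.

End Kronecker.

(** * Smooth maps carrying an independent constant field to a constant vector are affine *)

Section Rigidity.
Local Open Scope ring_scope.
Variables (R : realType) (n : nat).
Implicit Types (a b v x : 'rV[R]_n) (V : torus R n -> torus R n).

(** The hypothesis at every point of the orbit says that its image has constant velocity [b]. *)
Lemma smooth_map_flow V a b :
  smooth_map V -> (forall p, tangent_map V p a = b) ->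
  forall p t, V (p + torus_pi (t *: a)) = V p + torus_pi (t *: b).
Proof.
move=> smV hV p t.
have := @constant_velocity_curve _ _ (fun t => V (p + torus_pi (t *: a))) b.
rewrite /= scale0r torus_pi0 addr0; apply=> {}t.
rewrite -(hV (p + torus_pi (t *: a))).
have := smooth_map_velocity smV (p + torus_pi (t *: a)) a.
by under [X in _ -> X @ _ --> _]eq_fun do rewrite scalerDl torus_piD addrA.
Qed.

Lemma kronecker_torus a : rat_independent (fun i => a 0 i) ->
  forall (q : torus R n) (e : R), 0 < e ->
  exists t x, `|x| < e /\ q + torus_pi x = torus_pi (t *: a).
Proof.
move=> ha q e e0; have e2 : 0 < e / 2 by rewrite divr_gt0.
have [t [m h]] := kronecker_approximation ha (fun i => repr q 0 i) e2.
exists t, (t *: a - repr q - map_mx intr (\row_i m i)); split.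
  apply: (@le_lt_trans _ _ (e / 2)); last lra.
  by apply: row_norm_le => [|i]; [exact: ltW|rewrite !mxE ltW].
rewrite 2!torus_piB torus_pi_int subr0 torus_pi_repr; exact: subrKC.
Qed.

(** The identity is exact when [q] is on the orbit of 0. In general [q] is moved onto the orbit by a
    small [x], and continuity at [p + q] and at [q] costs [e / 2] each. *)
Lemma smooth_map_additive V a b : rat_independent (fun i => a 0 i) ->
  smooth_map V -> (forall p, tangent_map V p a = b) ->
  forall p q, V (p + q) - V q = V p - V 0.
Proof.
move=> ha smV hV p q; apply/eqP; rewrite -subr_eq0; apply/eqP.
apply/torus_log_norm_eq0/eqP; rewrite eq_le normr_ge0 andbT.
apply/ler_addgt0Pr => e e0; rewrite add0r.
have e2 : 0 < e / 2 by rewrite divr_gt0.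
have /cvgr0Pnorm_le /(_ _ e2) := smooth_map_cvg smV (p + q).
have /cvgr0Pnorm_le /(_ _ e2) := smooth_map_cvg smV q.
move=> h1 h2.
have /nbhs_norm0P [d /= d0 hd] : \forall x \near (0 : 'rV[R]_n),
    `|chart (V (p + q)) (V (p + q + torus_pi x))| <= e / 2 /\
    `|chart (V q) (V (q + torus_pi x))| <= e / 2 by exact: filterI.
have [t [x [xd hx]]] := kronecker_torus ha q d0.
have [{}h1 {}h2] := hd x xd.
have hpq : V (p + q + torus_pi x) - V (q + torus_pi x) = V p - V 0.
  rewrite -addrA hx (smooth_map_flow smV hV) -[torus_pi (t *: a)]add0r.
  by rewrite (smooth_map_flow smV hV) opprD addrACA subrr addr0.
rewrite -hpq.
have -> : V (p + q) - V q - (V (p + q + torus_pi x) - V (q + torus_pi x)) =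
  (V (q + torus_pi x) - V q) - (V (p + q + torus_pi x) - V (p + q)).
  rewrite !opprB addrACA [RHS]addrACA; congr (_ + _); exact: addrC.
apply: le_trans (torus_log_normD _ _) _; rewrite torus_log_normN (splitr e).
exact: lerD.
Qed.

Lemma smooth_map_affine V a b : rat_independent (fun i => a 0 i) ->
  smooth_map V -> (forall p, tangent_map V p a = b) ->
  exists B : 'M[int]_n,
    (forall x, V (torus_pi x) = V 0 + torus_pi (x *m map_mx intr B)) /\
    b = a *m map_mx intr B.
Proof.
move=> ha smV hV; have addV := smooth_map_additive ha smV hV.
pose L v := tangent_map V 0 v.
(* By additivity the velocity of [V] in the direction [v] is the same at all points of the line. *)
have lineV v t : V (torus_pi (t *: v)) = V 0 + torus_pi (t *: L v).
  have := @constant_velocity_curve _ _ (fun t => V (torus_pi (t *: v))) (L v).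
  rewrite /= scale0r torus_pi0; apply=> {}t.
  have := smooth_map_velocity smV 0 v; rewrite -/(L v).
  under [X in _ -> X @ _ --> _]eq_fun do
    rewrite scalerDl torus_piD /chart [torus_pi _ + _]addrC addV.
  by under eq_fun do rewrite add0r.
have Lint i j : L (delta_mx 0 i) 0 j \is a Num.int.
  move: j; apply/torus_pi_eq0.
  (* A coordinate circle closes up at time 1, and so must its image. *)
  have := lineV (delta_mx 0 i) 1; rewrite !scale1r.
  rewrite torus_pi_delta.
  by move=> /eqP; rewrite -subr_eq0 opprD addNKr oppr_eq0 => /eqP.
pose B := \matrix_(i, j) Num.floor (L (delta_mx 0 i) 0 j).
have hB i : row i (map_mx intr B) = L (delta_mx 0 i).
  by apply/rowP => j; rewrite !mxE; apply/eqP; rewrite -intrEfloor.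
have VB x : V (torus_pi x) = V 0 + torus_pi (x *m map_mx intr B).
  pose W x := V (torus_pi x) - V 0.
  have WD : {morph W : x y / x + y}.
    move=> y z; rewrite /W -(addV (torus_pi y) (torus_pi z)) -torus_piD.
    by rewrite addrA subrK.
  have W0 : W 0 = 0 by rewrite /W torus_pi0 subrr.
  apply/eqP; rewrite addrC -subr_eq -/(W x); apply/eqP.
  rewrite {1}(row_sum_delta x) (big_morph W WD W0) mulmx_sum_row.
  rewrite (big_morph _ (@torus_piD R n) (@torus_pi0 R n)).
  by apply: eq_bigr => i _; rewrite /W lineV hB addrAC subrr add0r.
exists B; split=> //; apply/eqP; rewrite -subr_eq0; apply/eqP.
(* Both descriptions of [V] on the orbit of 0 give [torus_pi (t *: w) = 0] for all [t]. This [t]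
   makes the norm of [t *: w] smaller than 1/2, so that [torus_log] recovers the vector. *)
set w := b - _; pose t := (2 * (1 + `|w|))^-1.
have t0 : 0 < t by rewrite invr_gt0 mulr_gt0 // ltr_pwDl.
have hw : torus_pi (t *: w) = 0.
  have := smooth_map_flow smV hV 0 t; rewrite add0r VB => /addrI h.
  by rewrite /w scalerBr torus_piB -h -scalemxAl subrr.
have : torus_log (torus_pi (t *: w)) = t *: w.
  apply: torus_log_small; rewrite normrZ gtr0_norm // /t invfM -mulrA.
  by rewrite gtr_pMr // mulrC ltr_pdivrMr ?ltr_pwDl // mul1r ltrDr.
rewrite hw torus_log0 => /esym/eqP; rewrite scaler_eq0 gt_eqF //= => /eqP.
exact.
Qed.

(** A nonzero integer vector [u] with [B u^T = 0] is a character that is trivial on the translate of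
    the image of [V] by [- V 0]. *)
Lemma affine_surjective_det V (B : 'M[int]_n) :
  (forall x, V (torus_pi x) = V 0 + torus_pi (x *m map_mx intr B)) ->
  (forall q, exists p, V p = q) -> \det B != 0.
Proof.
move=> VB surjV; rewrite -det_tr; apply/det0P => -[u u0 uB].
have [i ui] : exists i, u 0 i != 0 by exact/rV0Pn.
(* The pairing of [y] with [u] is 1/2, which is not an integer. *)
pose y : 'rV[R]_n := (2 * (u 0 i)%:~R)^-1 *: delta_mx 0 i.
have [p Vp] := surjV (V 0 + torus_pi y).
have := VB (repr p); rewrite torus_pi_repr Vp => /addrI /torus_pi_eqP[m ym].
have : (y *m map_mx intr u^T) 0 0 = ((m *m u^T) 0 0)%:~R.
  rewrite ym mulmxDl -mulmxA -!map_mxM /=.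
  have -> : B *m u^T = 0 by rewrite -[B]trmxK -trmx_mul uB trmx0.
  by rewrite raddf0 mulmx0 add0r mxE.
rewrite /y -scalemxAl -rowE !mxE => /(congr1 ( *%R 2)).
rewrite mulrA invfM mulrA mulfV // mul1r mulVf ?intr_eq0 //.
rewrite -[2]/(2%:~R) -intrM -[1]/(1%:~R) => /eqP; rewrite eqr_int; lia.
Qed.

(** [V] sends each row of the real inverse of [B] to [V 0], so injectivity makes that row
    integral. *)
Lemma affine_bijective_unit V (B : 'M[int]_n) :
  (forall x, V (torus_pi x) = V 0 + torus_pi (x *m map_mx intr B)) ->
  bijective V -> B \in unitmx.
Proof.
move=> VB [V' VK V'K].
have /affine_surjective_det dB : forall q, exists p, V p = q.
  by move=> q; exists (V' q).
pose M : 'M[R]_n := map_mx intr B.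
have uM : M \in unitmx by rewrite unitmxE det_map_mx unitfE intr_eq0 dB.
have hint i j : invmx M i j \is a Num.int.
  have /torus_pi_eq0 /(_ j) : torus_pi (row i (invmx M)) = 0.
    apply: (can_inj VK); rewrite VB -row_mul mulVmx // row1.
    by rewrite torus_pi_delta addr0.
  by rewrite mxE.
pose B' := \matrix_(i, j) Num.floor (invmx M i j).
have hB' : map_mx intr B' = invmx M.
  by apply/matrixP => i j; rewrite !mxE; apply/eqP; rewrite -intrEfloor.
suff /mulmx1_unit[] : B *m B' = 1%:M by [].
have inj : injective (map_mx intr : 'M[int]_n -> 'M[R]_n).
  move=> X Y /matrixP h; apply/matrixP => i j.
  by have /eqP := h i j; rewrite !mxE eqr_int => /eqP.
by apply: inj; rewrite map_mxM /= hB' mulmxV // map_mx1.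
Qed.

End Rigidity.

(** * Toral endomorphisms as smooth maps, and multipliers as eigenvalues of GL_n(Z) *)

Section AffineSmooth.
Local Open Scope ring_scope.
Variable R : realType.

Lemma iter_derive_near_eq (E F : normedModType R) (f g : E -> F) (x : E) s :
  {near x, f =1 g} -> {near x, iter_derive s f =1 iter_derive s g}.
Proof.
move=> fg; elim: s => [|v s IHs] //=.
have := near_join IHs; apply: filterS => y hy.
exact: near_eq_derive.
Qed.

Lemma smooth_near_eq (E F : normedModType R) (f g : E -> F) (x : E) :
  {near x, f =1 g} -> smooth_near f x -> smooth_near g x.
Proof.
move=> fg; have := near_join fg; apply: filterS2 => y {}fg fs s.
have [fc fd] := fs s; have hs := iter_derive_near_eq s fg.
split=> [|v]; last exact: near_eq_derivable hs (fd v).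
rewrite /prop_for /continuous_at -(nbhs_singleton hs).
exact: cvg_trans (near_eq_cvg hs) fc.
Qed.

Variable n : nat.
Implicit Types (A : 'M[R]_n) (c x v : 'rV[R]_n).

Lemma is_derive_affine A c x v :
  is_derive x v (fun y => y *m A + c) (v *m A).
Proof.
have h : (fun h => h^-1 *: ((h *: v + x) *m A + c - (x *m A + c))) @ (0 : R)^'
    --> v *m A.
  have hq : {near (0 : R)^', cst (v *m A) =1
      (fun h => h^-1 *: ((h *: v + x) *m A + c - (x *m A + c)))}.
    have : \forall h \near (0 : R)^', h != 0 by exact: nbhs_dnbhs_neq.
    apply: filterS => h h0; rewrite /= opprD addrACA subrr addr0 mulmxDl addrK.
    by rewrite -scalemxAl scalerA mulVf ?scale1r.
  exact: cvg_trans (near_eq_cvg hq) (cvg_cst _).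
by split; [apply/cvg_ex; exists (v *m A) | exact: (cvg_lim _ h)].
Qed.

Lemma affine_cvg A c x :
  (fun y : 'rV[R]_n => y *m A + c) @ x --> x *m A + c.
Proof.
have hA (G : set_system 'rV[R]_n) : Filter G ->
    (forall i, (fun y : 'rV[R]_n => y 0 i) @ G --> x 0 i) ->
    (fun y : 'rV[R]_n => y *m A + c) @ G --> x *m A + c.
  move=> FG h; apply: cvgD; last exact: cvg_cst.
  under eq_fun do rewrite mulmx_sum_row.
  rewrite mulmx_sum_row; apply: cvg_big => [|i _]; first exact: add_continuous.
  by apply: cvgZr_tmp; exact: h.
apply: (hA (nbhs x) (nbhs_filter x)) => i; exact: coord_continuous.
Qed.

Arguments affine_cvg : clear implicits.

(** Directional derivatives of affine maps are constant, so all iterated ones stay affine. *)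
Lemma smooth_near_affine A c x : smooth_near (fun y => y *m A + c) x.
Proof.
apply: (@filterE _ (nbhs x) (nbhs_filter x)) => y s.
have [A' [c' ->]] : exists A' c', iter_derive s (fun y => y *m A + c) =
    (fun y => y *m A' + c').
  elim: s => [|v s [A' [c' /= ->]]]; first by exists A, c.
  exists 0, (v *m A'); apply/funext => z.
  by rewrite mulmx0 add0r; have [_ ->] := is_derive_affine A' c' z v.
split=> [|v]; first exact: affine_cvg.
by have [] := is_derive_affine A' c' y v.
Qed.

Lemma torus_log_affine_near A c x : x *m A + c = 0 ->
  {near x, (fun y => torus_log (torus_pi (y *m A + c))) =1
    (fun y => y *m A + c)}.
Proof.
move=> x0; have := affine_cvg A c x; rewrite x0.
move=> /cvgr0_norm_lt /(_ 2^-1); rewrite invr_gt0 => /(_ (ltr0Sn _ _)).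
by apply: filterS => y; exact: torus_log_small.
Qed.

(** The endomorphism induced by [B]; [torus_linear_pi] shows that the choice of lift is
    immaterial. *)
Definition torus_linear (B : 'M[int]_n) (p : torus R n) : torus R n :=
  torus_pi (repr p *m map_mx intr B).

Lemma torus_linear_pi (B : 'M[int]_n) x :
  torus_linear B (torus_pi x) = torus_pi (x *m map_mx intr B).
Proof.
have /torus_pi_eqP[m hm] := torus_pi_repr (torus_pi x).
by rewrite /torus_linear hm mulmxDl -map_mxM torus_pi_intD.
Qed.

Lemma torus_linearM (B C : 'M[int]_n) p :
  torus_linear C (torus_linear B p) = torus_linear (B *m C) p.
Proof.
by rewrite -(torus_pi_repr p) !torus_linear_pi -mulmxA -map_mxM.
Qed.

Lemma torus_linear1 p : torus_linear 1%:M p = p.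
Proof. by rewrite /torus_linear map_mx1 mulmx1 torus_pi_repr. Qed.

Lemma smooth_torus_linear B : smooth_map (torus_linear B).
Proof.
move=> x; have hc y : chart ((torus_linear B \o torus_pi (n:=n)) x)
    ((torus_linear B \o torus_pi (n:=n)) y) =
    torus_log (torus_pi (y *m map_mx intr B - x *m map_mx intr B)).
  by rewrite /chart /= !torus_linear_pi torus_piB.
apply: smooth_near_eq
  (smooth_near_affine (map_mx intr B) (- (x *m map_mx intr B)) x).
have := torus_log_affine_near (subrr (x *m map_mx intr B)).
by apply: filterS => y h; rewrite hc; exact: esym.
Qed.

Lemma tangent_torus_linear B p v :
  tangent_map (torus_linear B) p v = v *m map_mx intr B.
Proof.
rewrite /tangent_map; have [_ <-] := is_derive_affine (map_mx intr B) 0 0 v.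
apply: near_eq_derive.
have := @torus_log_affine_near (map_mx intr B) 0 0; rewrite mul0mx addr0.
move=> /(_ erefl); apply: filterS => y <-.
rewrite addr0 /chart -(torus_pi_repr p) -torus_piD !torus_linear_pi -torus_piB.
by rewrite mulmxDl addrAC subrr add0r.
Qed.

(** The algebraic form of the multiplier group; [alpha != 0] is derived from [b != 0]. *)
Definition unit_multipliers (b : 'rV[R]_n) : set R :=
  [set alpha | exists2 B : 'M[int]_n,
    B \in unitmx & b *m map_mx intr B = alpha *: b].

Lemma rat_independent_neq0 (b : 'rV[R]_n) : (0 < n)%N ->
  rat_independent (fun i => b 0 i) -> b != 0.
Proof.
move=> n0 ib; apply/eqP => b0.
have := ib (fun=> 1) _ (Ordinal n0); rewrite b0 big1 => [/(_ erefl)/eqP|i _].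
  by rewrite oner_eq0.
by rewrite mxE mulr0.
Qed.

Lemma int_unitmx_map (B : 'M[int]_n) :
  B \in unitmx -> map_mx intr B \in @unitmx R n.
Proof. by move=> uB; rewrite unitmxE det_map_mx rmorph_unit -?unitmxE. Qed.

Lemma unit_multipliers_neq0 b alpha : b != 0 -> unit_multipliers b alpha ->
  alpha != 0.
Proof.
move=> b0 [B /int_unitmx_map uM bB]; apply: contra_neq b0 => al0.
by rewrite -(mulmxK uM b) bB al0 scale0r mul0mx.
Qed.

Lemma unit_multipliers_subgroup b : b != 0 -> mul_subgroup (unit_multipliers b).
Proof.
move=> b0; split=> [x|| x y hx hy]; first exact: unit_multipliers_neq0.
  by exists 1%:M; rewrite ?unitmx1 // map_mx1 mulmx1 scale1r.
have y0 := unit_multipliers_neq0 b0 hy.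
move: hx hy => [B uB bB] [C uC bC].
exists (B *m invmx C); first by rewrite unitmx_mul uB unitmx_inv.
apply: (can_inj (mulmxK (int_unitmx_map uC))).
rewrite -mulmxA -map_mxM mulmxKV // bB -scalemxAl bC scalerA.
by rewrite divfK.
Qed.

(** Rigidity makes the diffeomorphism affine with unimodular linear part; conversely
    [torus_linear B] realizes the multiplier. *)
Lemma multiplier_groupE (phi : flow R n) (b : 'rV[R]_n) : (0 < n)%N ->
  generated_by_constant phi b -> rat_independent (fun i => b 0 i) ->
  multiplier_group phi = unit_multipliers b.
Proof.
move=> n0 hb ib; apply/seteqP; split=> alpha.
  move=> [al0 [f [g [[sf sg fg gf] hf]]]].
  have hT p : tangent_map f p b = alpha *: b.
    by have := hf (f p); rewrite /Defs.pushforward fg !hb.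
  have [B [fB bB]] := smooth_map_affine ib sf hT.
  by exists B => //; apply: affine_bijective_unit fB _; exists g.
move=> ual; split.
  exact: unit_multipliers_neq0 (rat_independent_neq0 n0 ib) ual.
have [B uB bB] := ual.
exists (torus_linear B), (torus_linear (invmx B)); split.
  split; try exact: smooth_torus_linear; move=> p; rewrite torus_linearM.
    by rewrite mulmxV // torus_linear1.
  by rewrite mulVmx // torus_linear1.
by move=> q; rewrite /Defs.pushforward !hb tangent_torus_linear.
Qed.

End AffineSmooth.

(** * Change of rational basis by an integer matrix, and finiteness of the index *)

Section RatBasis.
Local Open Scope ring_scope.
Variables (R : realType) (n : nat).
Implicit Types (a b : 'rV[R]_n) (B : 'M[int]_n).

Lemma rat_combE a (c : 'I_n -> rat) :
  \sum_(i < n) ratr (c i) * a 0 i = (a *m map_mx ratr (\col_i c i)) 0 0.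
Proof. by rewrite mxE; apply: eq_bigr => i _; rewrite !mxE mulrC. Qed.

Lemma map_ratr_int B :
  map_mx ratr (map_mx intr B : 'M[rat]_n) = map_mx intr B :> 'M[R]_n.
Proof. by apply/matrixP => i j; rewrite !mxE ratr_int. Qed.

Lemma det_neq0_unitmx_map (K : numFieldType) B : \det B != 0 ->
  map_mx intr B \in @unitmx K n.
Proof. by move=> dB; rewrite unitmxE det_map_mx unitfE intr_eq0. Qed.

(** A relation [c] among the entries of [a B] is the relation [B c] among those of [a], and [B] is
    invertible over the rationals. *)
Lemma rat_independent_mulmx a B : \det B != 0 ->
  rat_independent (fun i => a 0 i) ->
  rat_independent (fun i => (a *m map_mx intr B) 0 i).
Proof.
move=> dB ia c; rewrite rat_combE -mulmxA -map_ratr_int -map_mxM => hc.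
pose d : 'cV[rat]_n := map_mx intr B *m \col_i c i.
have d0 i : d i 0 = 0.
  apply: (ia (fun i => d i 0)); rewrite rat_combE -[RHS]hc.
  by congr ((_ *m map_mx _ _) 0 0); apply/colP => j; rewrite mxE.
move=> i; have : \col_i c i = 0.
  apply: (can_inj (mulKmx (det_neq0_unitmx_map rat dB))); rewrite mulmx0.
  by apply/colP => j; rewrite [LHS]d0 mxE.
by move=> /colP/(_ i); rewrite !mxE.
Qed.

Lemma rat_basis_mulmx (F : {pred R}) a B (theta : R) :
  GRing.divring_closed F -> \det B != 0 ->
  rat_basis F (fun i => theta * a 0 i) ->
  rat_basis F (fun i => theta * (a *m map_mx intr B) 0 i).
Proof.
move=> cF dB [Fa ia spana].
pose e := theta *: a.
have eB i : theta * (a *m map_mx intr B) 0 i = (e *m map_mx intr B) 0 i.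
  by rewrite -scalemxAl [RHS]mxE.
have ea i : theta * a 0 i = e 0 i by rewrite mxE.
have ie : rat_independent (fun i => e 0 i).
  by move=> c hc; apply: ia; under eq_bigr do rewrite ea.
split=> [i|c hc|x /spana[c ->]].
- have zF : GRing.zmod_closed F := cF.
  pose S : zmodClosed R := HB.pack F (GRing.isZmodClosed.Build R F zF).
  rewrite eB mxE -[F]/(S : {pred R}); apply: rpred_sum => j _.
  by rewrite !mxE mulrzr rpredMz // Fa.
- apply: (rat_independent_mulmx dB ie) => //.
  by rewrite -[RHS]hc; apply: eq_bigr => i _; rewrite eB.
- pose d := invmx (map_mx intr B) *m \col_i c i.
  exists (fun i => d i 0).
  under eq_bigr do rewrite ea; under [RHS]eq_bigr do rewrite eB.
  rewrite !rat_combE -mulmxA; congr (fun_of_matrix (_ *m _) 0 0).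
  have -> : \col_i d i 0 = d by apply/colP => j; rewrite mxE.
  by rewrite -map_ratr_int -map_mxM mulKVmx ?det_neq0_unitmx_map.
Qed.

(** [N = B B'^-1] has eigenvector [a] for [alpha / alpha'], hence its conjugate by [C] has
    eigenvector [a C]; unimodularity passes through [C M = N C]. *)
Lemma unit_multipliers_congruence a (C B B' K : 'M[int]_n) (alpha alpha' : R) :
  a != 0 -> \det C != 0 -> B \in unitmx -> B' \in unitmx ->
  B = B' + \det C *: K ->
  a *m map_mx intr B = alpha *: a -> a *m map_mx intr B' = alpha' *: a ->
  unit_multipliers (a *m map_mx intr C) (alpha / alpha').
Proof.
move=> a0 dC uB uB' BB' aB aB'.
pose N := B *m invmx B'.
have aN : a *m map_mx intr N = (alpha / alpha') *: a.
  have al'0 : alpha' != 0 by apply: unit_multipliers_neq0 a0 _; exists B'.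
  apply: (can_inj (mulmxK (int_unitmx_map R uB'))).
  rewrite -mulmxA -map_mxM /N mulmxKV // aB -scalemxAl aB' scalerA.
  by rewrite mulfVK.
(* M = C^-1 N C, which is integral because N = 1 modulo det C. *)
pose M := 1%:M + \adj C *m (K *m invmx B') *m C.
have CM : C *m M = N *m C.
  rewrite /M /N BB' mulmxDr mulmx1 !mulmxA mul_mx_adj mulmxDl mulmxV //.
  by rewrite mulmxDl mul1mx mul_scalar_mx -!scalemxAl.
exists M.
  rewrite unitmxE; have : \det M * \det C = \det N * \det C.
    by rewrite mulrC -!det_mulmx CM.
  move=> /(mulIf dC) ->.
  by rewrite -unitmxE unitmx_mul uB unitmx_inv.
by rewrite -mulmxA -map_mxM CM map_mxM mulmxA aN -scalemxAl.
Qed.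

Lemma unit_multipliers_finite_index a (C : 'M[int]_n) :
  a != 0 -> \det C != 0 ->
  finite_set [set [set x * y | y in unit_multipliers (a *m map_mx intr C)]
    | x in unit_multipliers a].
Proof.
move=> a0 dC; set H := unit_multipliers (a *m _); set G := unit_multipliers a.
pose coset x := [set x * y | y in H].
(* One matrix is fixed for each multiplier, with 0 as a dummy outside [G]. *)
have : forall x, exists B : 'M[int]_n, G x ->
    B \in unitmx /\ a *m map_mx intr B = x *: a.
  move=> x; have [[B uB aB]|nGx] := pselect (G x); first by exists B.
  by exists 0.
move=> /choice[Bx hBx].
pose d := \det C.
(* Residues modulo [d] lie below [|d|]; the size is a successor because [inord] requires one. *)
pose red x : 'M['I_(`|d|%N).+1]_n :=
  map_mx (fun z : int => inord `|(z %% d)%Z|%N) (Bx x).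
have redP x x' : G x -> G x' -> red x = red x' -> H (x / x').
  move=> Gx Gx' /matrixP hr.
  have [uB aB] := hBx _ Gx; have [uB' aB'] := hBx _ Gx'.
  apply: (@unit_multipliers_congruence a C _ _
    (\matrix_(i, j) ((Bx x i j - Bx x' i j) %/ d)%Z) x x'
    a0 dC uB uB' _ aB aB').
  apply/matrixP => i j; have := hr i j; rewrite !mxE => /(congr1 val) /=.
  have dlt z : (`|(z %% d)%Z| < `|d|.+1)%N.
    rewrite ltnS ltnW // -ltz_nat gez0_abs ?modz_ge0 //; exact: ltz_mod.
  rewrite !inordK // => hmod.
  have dvd : (d %| Bx x i j - Bx x' i j)%Z.
    rewrite -eqz_mod_dvd; apply/eqP.
    by rewrite -[LHS]gez0_abs ?modz_ge0 // hmod gez0_abs ?modz_ge0.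
  by rewrite mulrC divzK // addrC subrK.
have cosetP x x' : G x -> G x' -> red x = red x' -> coset x `<=` coset x'.
  move=> Gx Gx' hr _ [y Hy <-].
  have x'0 := unit_multipliers_neq0 a0 Gx'.
  have b0 : a *m map_mx intr C != 0.
    apply: contra_neq a0 => b0.
    by rewrite -(mulmxK (det_neq0_unitmx_map R dC) a) b0 mul0mx.
  have [Hn0 H1 Hdiv] := unit_multipliers_subgroup b0.
  exists (x / x' * y); last by rewrite mulrA mulrC; field.
  (* Subgroup closure is stated for quotients, so the product is written as one. *)
  have -> : x / x' * y = (x / x') / (1 / y) by rewrite div1r invrK.
  by apply: (Hdiv _ _ (redP _ _ Gx Gx' hr)); exact: Hdiv.
(* Every coset comes from the chosen representative of a residue matrix; matrices that are not
   residues of a multiplier get the default 0. *)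
pose rep t := xget 0 [set x | G x /\ red x = t].
apply: (@sub_finite_set _ _ ((coset \o rep) @` [set: 'M['I_(`|d|%N).+1]_n])).
  move=> _ [x Gx <-]; exists (red x) => //=.
  have [Gr hr] : [set y | G y /\ red y = red x] (rep (red x)).
    by apply: (@xgetPex _ 0); exists x.
  by apply/seteqP; split; apply: cosetP.
exact: finite_image.
Qed.

End RatBasis.

(** * Transfer from [phi] to [psi] along the integer matrix of the semiconjugacy *)

Unset Implicit Arguments.
Set Strict Implicit.
Set Printing Implicit Defensive.

Theorem theorem3p2 (R : realType) (n : nat) (hn : (2 <= n)%N)
    (F : {pred R}) (hF : real_number_field n F)
    (phi psi : flow R n)
    (hphi : algebraic_flow F phi)
    (hpsi : exists b, generated_by_constant psi b)
    (hconj : smoothly_semiconjugate phi psi)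
    (hM : multiplier_group psi `<=` multiplier_group phi) :
  algebraic_flow F psi /\
  finite_index_subgroup (multiplier_group psi) (multiplier_group phi).
Proof.
have n0 : (0 < n)%N by exact: ltnW.
have [cF _] := hF.
have [a [[ga ia] [theta [th0 ba]]]] := hphi.
have [b gb] := hpsi.
have [V [smV surjV TV]] := hconj.
have hV p : tangent_map V p a = b by rewrite -(ga p) TV gb.
have [B [VB bE]] := smooth_map_affine ia smV hV.
have dB := affine_surjective_det VB surjV.
have ib : rat_independent (fun i => b 0%R i).
  by rewrite bE; exact: rat_independent_mulmx.
have a0 := rat_independent_neq0 n0 ia.
have b0 := rat_independent_neq0 n0 ib.
split.
  (* The scaling [theta] of [a] also serves [b = a B]. *)
  exists b; split=> //; exists theta; split=> //.
  by rewrite bE; exact: rat_basis_mulmx.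
rewrite (multiplier_groupE n0 ga ia) (multiplier_groupE n0 gb ib) in hM *.
split=> //; try exact: unit_multipliers_subgroup.
by rewrite bE; exact: unit_multipliers_finite_index.
Qed.
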